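(* Let $\Pi_1,\Pi_2,\Pi_3$ be planar networks of rank $n$ such that each $\Pi_i$ has an $n$-multipath, and let $w_i\in\mathbb T^{\Pi_i}$, $i=1,2,3$. Then the values $m_{\underline\alpha}=m_{\underline\alpha}(w_1,w_2,w_3)$, $\underline\alpha\in\Delta^3(n)$, satisfy the rhombus inequalities: for each small rhombus in $\Delta^3(n)$ with short diagonal $\{\underline\gamma,\underline\delta\}$ and long diagonal $\{\underline\alpha,\underline\beta\}$, $$m_{\underline\gamma}+m_{\underline\delta}\ \ge\ m_{\underline\alpha}+m_{\underline\beta}.$$
   Context: **Planar networks.** $\mathbb T=\mathbb R\cup\{-\infty\}$. A planar network of rank $n$ is a finite planar graph embedded in a strip $0\le x\le r$ with no vertical edges, oriented from left to right, with $n$ sources on $x=0$ and $n$ sinks on $x=r$, each labelled $1,\dots,n$ from bottom to top. A weighting is a map $w$ from edges to $\mathbb T$; $\mathbb T^\Pi$ is the set of weightings. Concatenation $\Pi_1\circ\Pi_2$ glues the $i$-th sink of $\Pi_1$ to the $i$-th source of $\Pi_2$. An $a$-multipath in $\Pi$ is a collection of $a$ pairwise vertex-disjoint oriented paths from sources to sinks. For $\underline\alpha=(\alpha_1,\alpha_2,\alpha_3)\in\mathbb Z_{\ge0}^3$, an $\underline\alpha$-multipath in $\Pi_1\circ\Pi_2\circ\Pi_3$ is a triple $(p_1,p_2,p_3)$ of pairwise vertex-disjoint multipaths, $p_i$ being an $\alpha_i$-multipath in $\Pi_1\circ\dots\circ\Pi_i$ (starting at sources of $\Pi_1$ and ending at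 sinks of $\Pi_i$). Its weight is the sum of the weights of all its edges. **The function $m$.** $\Delta^3(n)=\{(x_1,x_2,x_3)\in\mathbb Z_{\ge0}^3:x_1+x_2+x_3\le n\}$. For $\underline\alpha\in\Delta^3(n)$, $m_{\underline\alpha}(w_1,w_2,w_3)$ is the maximal weight of an $\underline\alpha$-multipath in $\Pi_1\circ\Pi_2\circ\Pi_3$ ($-\infty$ if there is none), with $m_{0,0,0}=0$. **Small rhombi** are the images of the rhombus $(0,0,0),(1,0,0),(1,1,0),(0,1,0)$ (long diagonal $(0,0,0),(1,1,0)$, short diagonal $(1,0,0),(0,1,0)$) under the $S_4$-action on the tetrahedron and translations. Explicitly, identify $\Delta^3(n)$ with $\{x\in\mathbb Z_{\ge0}^4:x_0+x_1+x_2+x_3=n\}$ via $x_0=n-x_1-x_2-x_3$; for pairwise distinct $a,b,c\in\{0,1,2,3\}$ and $y\in\mathbb Z^4_{\ge0}$ with $\sum y_i=n-2$ there is a small rhombus with short diagonal $\{y+e_a+e_b,y+e_a+e_c\}$ and long diagonal $\{y+2e_a,y+e_b+e_c\}$. *)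

(* Defs.v *)
From HB Require Import structures.
From mathcomp Require Import all_boot all_order all_algebra.
From mathcomp Require Import all_classical reals ereal topology normedtype.

Set Implicit Arguments.
Unset Strict Implicit.
Unset Printing Implicit Defensive.

Import Order.TTheory GRing.Theory Num.Theory.
Import numFieldNormedType.Exports.

Local Open Scope ring_scope.

(* Sources and sinks are labelled 0, ..., n - 1 instead of 1, ..., n. *)
Record network (n : nat) := Network {
  vertex : finType;
  edge : finType;
  edge_src : edge -> vertex;
  edge_dst : edge -> vertex;
  source : 'I_n -> vertex;
  sink : 'I_n -> vertex }.

(* A drawing of N in the strip 0 <= x <= width.  The edge e is drawn as the
   graph of [curve e] between the abscissas of its endpoints: this says at once
   that e is not vertical and runs from left to right, and covers straight
   edges as well as bent and parallel ones.  By [vertex_on_edge], the vertex in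
   [edges_meet_at_vertex] is a common endpoint of e and f. *)
Record planar_embedding (R : realType) (n : nat) (N : network n) :=
  PlanarEmbedding {
  width : R;
  px : vertex N -> R;
  py : vertex N -> R;
  curve : edge N -> R -> R;
  width_gt0 : 0 < width;
  in_strip : forall v, 0 <= px v <= width;
  position_inj : injective (fun v => (px v, py v));
  source_px : forall i, px (source N i) = 0;
  sink_px : forall i, px (sink N i) = width;
  source_py : forall i j : 'I_n,
    (i < j)%N -> py (source N i) < py (source N j);
  sink_py : forall i j : 'I_n, (i < j)%N -> py (sink N i) < py (sink N j);
  left_to_right : forall e, px (edge_src e) < px (edge_dst e);
  curve_continuous : forall e,
    ({within `[px (edge_src e), px (edge_dst e)],
        continuous (curve e)})%classic;
  curve_src : forall e, curve e (px (edge_src e)) = py (edge_src e);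
  curve_dst : forall e, curve e (px (edge_dst e)) = py (edge_dst e);
  vertex_on_edge : forall v e, px (edge_src e) <= px v <= px (edge_dst e) ->
    curve e (px v) = py v -> v = edge_src e \/ v = edge_dst e;
  edges_meet_at_vertex : forall e f t, e != f ->
    px (edge_src e) <= t <= px (edge_dst e) ->
    px (edge_src f) <= t <= px (edge_dst f) ->
    curve e t = curve f t -> exists v, px v = t /\ py v = curve e t }.

Record planar_network (R : realType) (n : nat) := PlanarNetwork {
  graph :> network n;
  embedding : planar_embedding R graph }.

Section Concatenation.
Variables (n : nat) (N1 N2 : network n).

(* The i-th source of N2 is identified with the i-th sink of N1 and represented
   by the latter. *)
Definition concat_vertex : finType :=
  (vertex N1 + {v : vertex N2 | [forall i, source N2 i != v]})%type.

Lemma concat_subproof (v : vertex N2) :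
  (fun i => source N2 i == v) =1 xpred0 -> [forall i, source N2 i != v].
Proof. by move=> no; apply/forallP => i; rewrite no. Qed.

Definition concat_glue (v : vertex N2) : concat_vertex :=
  match pickP (fun i => source N2 i == v) with
  | Pick i _ => inl (sink N1 i)
  | Nopick no => inr (exist _ v (concat_subproof no))
  end.

Definition concat : network n :=
  @Network n concat_vertex (edge N1 + edge N2)%type
    (fun e => match e with inl e1 => inl (edge_src e1)
                         | inr e2 => concat_glue (edge_src e2) end)
    (fun e => match e with inl e1 => inl (edge_dst e1)
                         | inr e2 => concat_glue (edge_dst e2) end)
    (fun i => inl (source N1 i))
    (fun i => concat_glue (sink N2 i)).

Definition concat_inl (v : vertex N1) : vertex concat := inl v.

Definition concat_weight (T : Type) (w1 : edge N1 -> T) (w2 : edge N2 -> T)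
    (e : edge concat) : T :=
  match e with inl e1 => w1 e1 | inr e2 => w2 e2 end.

End Concatenation.

Section Multipath.
Variables (n : nat) (N : network n).

(* Planar networks are acyclic, so a path never repeats an edge and its length
   is at most the number of edges; the bound only serves to make a finType. *)
Definition edge_seq : finType := #|edge N|.-bseq (edge N).

(* The empty sequence is excluded: no source of a planar network, or of a
   concatenation of planar networks, is a sink. *)
Definition is_path (s : seq (edge N)) : bool :=
  if s is e :: s' then
    [&& edge_src e \in codom (source N),
        path (fun e1 e2 => edge_dst e1 == edge_src e2) e s' &
        edge_dst (last e s') \in codom (sink N)]
  else false.

Definition path_vertices (s : seq (edge N)) : {set vertex N} :=
  [set v in map (@edge_src n N) s ++ map (@edge_dst n N) s].

Definition is_multipath (a : nat) (P : {set edge_seq}) : bool :=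
  [&& #|P| == a,
      [forall s in P, is_path s] &
      [forall s in P, forall t in P,
         (s != t) ==> [disjoint path_vertices s & path_vertices t]]].

Definition multipath_vertices (P : {set edge_seq}) : {set vertex N} :=
  (\bigcup_(s in P) path_vertices s)%SET.

Definition multipath_weight (R : realType) (w : edge N -> \bar R)
    (P : {set edge_seq}) : \bar R :=
  (\sum_(s in P) \sum_(e <- (s : seq (edge N))) w e)%E.

End Multipath.

Section RhombusFunction.
Variables (R : realType) (n : nat) (N1 N2 N3 : network n).
Variables (w1 : edge N1 -> \bar R) (w2 : edge N2 -> \bar R)
          (w3 : edge N3 -> \bar R).

Let N12 : network n := concat N1 N2.
Let N123 : network n := concat N12 N3.
Let w12 : edge N12 -> \bar R := concat_weight w1 w2.
Let w123 : edge N123 -> \bar R := concat_weight w12 w3.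

Definition multipath3 : finType :=
  ({set edge_seq N1} * {set edge_seq N12} * {set edge_seq N123})%type.

Definition is_multipath3 (alpha : nat * nat * nat) (p : multipath3) : bool :=
  let: (a1, a2, a3) := alpha in
  let: (p1, p2, p3) := p in
  let V1 : {set vertex N123} :=
    [set concat_inl N3 (concat_inl N2 v) | v in multipath_vertices p1] in
  let V2 : {set vertex N123} :=
    [set concat_inl N3 v | v in multipath_vertices p2] in
  let V3 : {set vertex N123} := multipath_vertices p3 in
  [&& is_multipath a1 p1, is_multipath a2 p2, is_multipath a3 p3,
      [disjoint V1 & V2], [disjoint V1 & V3] & [disjoint V2 & V3]].

Definition multipath3_weight (p : multipath3) : \bar R :=
  let: (p1, p2, p3) := p in
  (multipath_weight w1 p1 + multipath_weight w12 p2
   + multipath_weight w123 p3)%E.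

Definition max_weight (alpha : nat * nat * nat) : \bar R :=
  \big[maxe/-oo%E]_(p : multipath3 | is_multipath3 alpha p)
    multipath3_weight p.

End RhombusFunction.

(* Inverse of the identification (x1, x2, x3) |-> (x0, x1, x2, x3),
   x0 = n - x1 - x2 - x3. *)
Definition drop_x0 (x : 'I_4 -> nat) : nat * nat * nat :=
  (x (inord 1), x (inord 2), x (inord 3)).

(* The short diagonal is {gamma, delta}, the long diagonal {alpha, beta}. *)
Definition small_rhombus (n : nat) (gamma delta alpha beta : nat * nat * nat)
    : Prop :=
  exists (y : 'I_4 -> nat) (a b c : 'I_4),
    [/\ (\sum_i y i + 2 = n)%N, [&& a != b, a != c & b != c],
        gamma = drop_x0 (fun i => y i + (i == a) + (i == b))%N /\
        delta = drop_x0 (fun i => y i + (i == a) + (i == c))%N,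
        alpha = drop_x0 (fun i => y i + 2 * (i == a))%N &
        beta = drop_x0 (fun i => y i + (i == b) + (i == c))%N].

(* Main.v *)
(** Join a node L_0 to the sources, join the sinks of Pi_i to a node L_i, and
    split every vertex into an arc from its incoming to its outgoing half.  An
    alpha-multipath is then a set of arcs that conserves flow outside the L_k
    and has divergence n [k = 0] - alpha_k at L_k, with alpha_0 the number of
    unused sources; the converse holds because the network is acyclic.  Let F
    and G be the flows of optimal multipaths for alpha = y + 2 e_a and
    beta = y + e_b + e_c.  In the residual graph of F - G (arcs of F only, and
    arcs of G only reversed) the divergence is positive at L_b and L_c and
    negative only at L_a, so there is a path from L_c to L_a.  Exchanging F and
    G along it preserves the total weight and turns (alpha, beta) into
    (delta, gamma).  Planarity serves only to exclude directed cycles. *)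

Require Import Defs.
From mathcomp Require Import all_boot all_order all_algebra.
From mathcomp Require Import zify.

Set Implicit Arguments.
Unset Strict Implicit.
Unset Printing Implicit Defensive.

Import Order.TTheory GRing.Theory Num.Theory.

Local Open Scope ring_scope.

(** * Divergence of arc sets in a finite directed graph *)

Section Divergence.
Variables (N A : finType) (tl hd : A -> N).
Implicit Types (D H : {set A}) (a : A) (x u v : N).

Definition incidence a x : int := (tl a == x)%:Z - (hd a == x)%:Z.

Definition divergence D x : int := \sum_(a in D) incidence a x.

Lemma divergence_indicator D x :
  divergence D x = \sum_a (a \in D)%:Z * incidence a x.
Proof.
rewrite /divergence big_mkcond; apply: eq_bigr => a _.
by case: (a \in D); rewrite ?mul1r ?mul0r.
Qed.

Lemma divergenceU1 D a x :
  a \notin D -> divergence (a |: D) x = incidence a x + divergence D x.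
Proof. by move=> aD; rewrite /divergence big_setU1. Qed.

Lemma divergenceD1 D a x :
  a \in D -> divergence (D :\ a) x = divergence D x - incidence a x.
Proof.
by move=> aD; rewrite /divergence (big_setD1 a aD) /= addrAC subrr add0r.
Qed.

(** Consecutive arcs cancel at the node they share, so only the two ends remain. The sum runs over a
    list, so a walk may repeat arcs here. *)
Lemma sum_incidence_walk a s x : path (fun b c => hd b == tl c) a s ->
  \sum_(b <- a :: s) incidence b x =
    (tl a == x)%:Z - (hd (last a s) == x)%:Z.
Proof.
elim: s a => [|b s IHs] a /=; first by rewrite big_seq1.
by case/andP => /eqP ab /IHs; rewrite big_cons => ->; rewrite /incidence ab; lia.
Qed.

Definition adjacent D x y := [exists a in D, (tl a == x) && (hd a == y)].

(** A connecting path can be shortened until it repeats no node. It then uses each arc at most once,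
    so its arcs form a set and the divergence telescopes. *)
Lemma connect_subflow D u v : connect (adjacent D) u v ->
  exists2 H : {set A}, H \subset D &
    forall x, divergence H x = (u == x)%:Z - (v == x)%:Z.
Proof.
case/connectP => p0 /shortenP [p pp uniq_p _] -> {v}.
(* The clause on tails strengthens the induction: [u] does not occur on the rest of the path, so the
   arc leaving [u] is new to [H]. *)
suff: exists H : {set A}, [/\ H \subset D,
    {in H, forall a, tl a \in u :: p} &
    forall x, divergence H x = (u == x)%:Z - (last u p == x)%:Z].
  by case=> H [HD _ Hdiv]; exists H.
elim: p u pp uniq_p {p0} => [|z p IHp] u /=.
  exists set0; split=> [|a|x]; rewrite ?sub0set ?inE //.
  by rewrite /divergence big_set0 subrr.
case/andP => /exists_inP [a aD /andP [/eqP tla /eqP hda]] pp /andP [uz uniq_p].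
have [H [HD Htl Hdiv]] := IHp z pp uniq_p.
have aH : a \notin H by apply: contra uz => /Htl; rewrite tla.
exists (a |: H); split=> [|b|x].
- by apply/subsetP => b; rewrite !inE => /orP [/eqP ->|/(subsetP HD)].
- rewrite !inE => /orP [/eqP ->|/Htl]; first by rewrite tla eqxx.
  by rewrite inE => ->; rewrite orbT.
- by rewrite divergenceU1 // Hdiv /incidence tla hda; lia.
Qed.

(* Nothing leaves the set X of nodes reachable from u, so the total divergence
   of D over X is not positive. *)
Lemma connect_divergence D u v : 0 < divergence D u ->
  (forall x, x != v -> 0 <= divergence D x) -> connect (adjacent D) u v.
Proof.
move=> u_gt0 ge0; apply/negPn/negP => uv.
pose X := connect (adjacent D) u.
have : \sum_(x | X x) divergence D x <= 0.
  rewrite exchange_big /=; apply: sumr_le0 => a aD.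
  have sum_eq y : \sum_(x | X x) (y == x)%:Z = (X y)%:Z.
    rewrite big_mkcond (bigD1 y) //= eqxx big1 => [|z /negPf zy].
      by case: (X y).
    by rewrite eq_sym zy; case: (X z).
  rewrite sumrB !sum_eq subr_le0 lez_nat.
  case Xt: (X (tl a)) => //; rewrite (_ : X (hd a) = true) //.
  apply: connect_trans Xt _; apply: connect1.
  by apply/exists_inP; exists a => //; rewrite !eqxx.
(* As [v] is unreachable, it lies outside [X]; all terms of the sum are then nonnegative and the one
   at [u] is positive, a contradiction. *)
rewrite (bigD1 u) /=; last exact: connect0.
rewrite leNgt => /negP; apply.
apply: ltr_wpDr u_gt0; apply: sumr_ge0 => x /andP [Xx _].
by apply: ge0; apply: contraNneq uv => <-.
Qed.

Lemma unit_subflow D u v : 0 < divergence D u ->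
  (forall x, x != v -> 0 <= divergence D x) ->
  exists2 H : {set A}, H \subset D &
    forall x, divergence H x = (u == x)%:Z - (v == x)%:Z.
Proof. by move=> u_gt0 ge0; apply: connect_subflow (connect_divergence _ _). Qed.

End Divergence.

(** * Exchange of two flows along a residual path *)

Section Exchange.
Variables (N A : finType) (tl hd : A -> N).

(* In the residual graph the arcs of F only are kept and those of G only are
   reversed; exchanging F and G along a residual path moves one unit. *)
Lemma flow_exchange (F G : {set A}) (u v : N) :
  divergence tl hd G u < divergence tl hd F u ->
  (forall x, x != v -> divergence tl hd G x <= divergence tl hd F x) ->
  exists F' G' : {set A}, [/\
    forall a, ((a \in F') + (a \in G') = (a \in F) + (a \in G))%N,
    forall x, divergence tl hd F' x =
              divergence tl hd F x - (u == x)%:Z + (v == x)%:Z &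
    forall x, divergence tl hd G' x =
              divergence tl hd G x + (u == x)%:Z - (v == x)%:Z].
Proof.
move=> lt_u le_x.
(* Testing membership in [F] alone suffices: an arc of [D] outside [F] belongs to [G] only. *)
pose tl' a := if a \in F then tl a else hd a.
pose hd' a := if a \in F then hd a else tl a.
pose D := [set a | (a \in F) != (a \in G)].
have D_div x : divergence tl' hd' D x =
    divergence tl hd F x - divergence tl hd G x.
  rewrite !divergence_indicator -sumrB; apply: eq_bigr => a _.
  rewrite inE /incidence /tl' /hd'.
  by case: (a \in F); case: (a \in G); rewrite /= ?mul1r ?mul0r; lia.
have [||H HD Hdiv] := @unit_subflow N A tl' hd' D u v.
- by rewrite D_div subr_gt0.
- by move=> x xv; rewrite D_div subr_ge0 le_x.
have HE a : a \in H -> (a \in F) != (a \in G).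
  by move=> /(subsetP HD); rewrite inE.
(* Every arc of [H] lies in exactly one of [F] and [G]; toggling it in both sets moves it from one
   to the other. *)
exists [set a | (a \in F) (+) (a \in H)], [set a | (a \in G) (+) (a \in H)].
split=> [a|x|x].
- move: (HE a); rewrite !inE.
  by case: (a \in H); case: (a \in F); case: (a \in G) => //= /(_ isT).
- transitivity (divergence tl hd F x - divergence tl' hd' H x).
    rewrite !divergence_indicator -sumrB; apply: eq_bigr => a _.
    rewrite inE /incidence /tl' /hd'.
    by case: (a \in F); case: (a \in H); rewrite /= ?mul1r ?mul0r; lia.
  by rewrite Hdiv; lia.
- transitivity (divergence tl hd G x + divergence tl' hd' H x).
    rewrite !divergence_indicator -big_split; apply: eq_bigr => a _ /=.
    move: (HE a); rewrite inE /incidence /tl' /hd'.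
    case: (a \in G); case: (a \in F); case: (a \in H); rewrite /= ?mul1r ?mul0r;
      by [lia | move=> /(_ isT)].
  by rewrite Hdiv; lia.
Qed.

End Exchange.

(** * Decomposition of a flow into walks between terminal nodes *)

Section WalkDecomposition.
Variables (N A : finType) (tl hd : A -> N) (Z : pred N).
Implicit Types (D : {set A}) (a : A) (s : seq A).

Definition terminal_walk s :=
  if s is a :: s' then
    [&& Z (tl a), path (fun b c => hd b == tl c) a s' & Z (hd (last a s'))]
  else false.

(** [D] is the rest of a flow from which the walk up to [a] has been removed: outside [Z] its only
    imbalance is one unit at [hd a]. If [hd a] is not terminal, some arc of [D] must leave it; that
    arc prolongs the walk and is removed in turn, until [Z] is reached. *)
Lemma finish_walk D a :
  (forall x, ~~ Z x -> divergence tl hd D x = (hd a == x)%:Z) ->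
  exists s D', [/\ path (fun b c => hd b == tl c) a s, Z (hd (last a s)),
    perm_eq (enum D) (s ++ enum D') &
    forall x, ~~ Z x -> divergence tl hd D' x = 0].
Proof.
have [m] := ubnP #|D|; elim: m D a => // m IHm D a; rewrite ltnS => leDm Ddiv.
have [Za|nZa] := boolP (Z (hd a)).
  exists [::], D; split=> // x nZx; rewrite Ddiv //.
  by case: eqP nZx Za => // -> /negP.
have [b bD tlb] : exists2 b, b \in D & hd a = tl b.
  apply/'exists_in_eqP; apply: contraT => /exists_inPn none.
  have := Ddiv _ nZa; rewrite eqxx => div1.
  suff : divergence tl hd D (hd a) <= 0 by rewrite div1.
  apply: sumr_le0 => b bD; rewrite /incidence.
  by rewrite eq_sym (_ : (hd a == tl b) = false) ?(negPf (none b bD)) //; lia.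
have [||s [D' [s_path Zs Dperm D'div]]] := IHm (D :\ b) b.
- by move: leDm; rewrite (cardsD1 b) bD.
- move=> x nZx; rewrite divergenceD1 // Ddiv // /incidence tlb; lia.
exists (b :: s), D'; split=> //=; first by rewrite tlb eqxx.
apply: perm_trans (_ : perm_eq _ (b :: enum (D :\ b))) _;
  last by rewrite perm_cons.
apply: uniq_perm; rewrite /= ?enum_uniq ?mem_enum ?inE ?eqxx //.
by move=> x; rewrite !(inE, mem_enum); case: eqP => // ->.
Qed.

(** No arc of [D] enters a tail of least rank, so conservation forces that tail into [Z]. A walk
    from there to [Z] is stripped off, which leaves a smaller conserved flow. The increasing rank
    excludes circulations, which no terminal walk would cover. *)
Lemma walk_decomposition (rank : N -> nat) D :
  (forall a, rank (tl a) < rank (hd a))%N ->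
  (forall x, ~~ Z x -> divergence tl hd D x = 0) ->
  exists2 L, perm_eq (enum D) (flatten L) & all terminal_walk L.
Proof.
move=> rank_lt; have [m] := ubnP #|D|; elim: m D => // m IHm D leDm Ddiv.
have [->|[a0 a0D]] := set_0Vmem D.
  by exists [::] => //=; rewrite enum_set0.
have [a aD a_min] := arg_minnP (rank \o tl) a0D.
have Za : Z (tl a).
  apply: contraT => /Ddiv div0.
  suff : 0 < divergence tl hd D (tl a) by rewrite div0.
  rewrite /divergence (big_setD1 a) //= ltr_pwDl //.
    rewrite /incidence eqxx; case: eqP => // eq_a.
    by have := rank_lt a; rewrite eq_a ltnn.
  apply: sumr_ge0 => b; rewrite !inE => /andP [_ bD]; rewrite /incidence.
  case: (hd b =P tl a) => [eq_b|]; last by lia.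
  by have := a_min b bD; have := rank_lt b; rewrite /= eq_b; lia.
have [|s [D' [s_path Zs Dperm D'div]]] := @finish_walk (D :\ a) a.
  move=> x nZx; rewrite divergenceD1 // Ddiv // /incidence.
  by case: eqP nZx Za => [<- /negP//|_ _ _]; rewrite opprB subr0 add0r.
have aDperm : perm_eq (enum D) (a :: enum (D :\ a)).
  apply: uniq_perm; rewrite /= ?enum_uniq ?mem_enum ?inE ?eqxx //.
  by move=> x; rewrite !(inE, mem_enum); case: eqP => // ->.
have [|L Lperm Lwalk] := IHm D' _ D'div.
  move: leDm; rewrite !cardE (perm_size aDperm) /= (perm_size Dperm) size_cat.
  by rewrite !ltnS; apply: leq_ltn_trans; rewrite leq_addl.
exists ((a :: s) :: L); last by rewrite /= Za s_path Zs.
apply: perm_trans aDperm _; rewrite /= perm_cons.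
by apply: perm_trans Dperm _; rewrite perm_cat2l.
Qed.

End WalkDecomposition.

(** * Duplicate-free concatenations and pairwise disjointness *)

Lemma uniq_flatten_map (S T : eqType) (f : S -> seq T) (L : seq S) :
  uniq L -> {in L, forall x, uniq (f x)} ->
  {in L &, forall x y, x != y -> ~~ has (mem (f x)) (f y)} ->
  uniq (flatten (map f L)).
Proof.
elim: L => //= x L IHL /andP [xL uL] fu fd.
rewrite cat_uniq fu ?mem_head // IHL //; last first.
- by move=> y z yL zL; apply: fd; rewrite inE ?yL ?zL orbT.
- by move=> y yL; apply: fu; rewrite inE yL orbT.
rewrite andbT; apply/hasPn => v /flatten_mapP [y yL vy].
have yxL : y \in x :: L by rewrite inE yL orbT.
have xy : x != y by apply: contraNneq xL => ->.
by have /hasPn := fd x y (mem_head _ _) yxL xy; apply.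
Qed.

Lemma uniq_flatten_map_disjoint (S T : eqType) (f : S -> seq T) (L : seq S) x y :
  uniq (flatten (map f L)) -> x \in L -> y \in L -> x != y ->
  ~~ has (mem (f x)) (f y).
Proof.
elim: L => //= z L IHL; rewrite cat_uniq => /and3P [_ /hasPn zL uL].
have dz v t : t \in L -> v \in f t -> v \notin f z.
  by move=> tL vt; apply: zL; apply/flatten_mapP; exists t.
rewrite !inE => /predU1P [->|xL] /predU1P [->|yL] xy.
- by rewrite eqxx in xy.
- by apply/hasPn => v /(dz v y yL).
- by apply/hasPn => v vz; apply: contraL vz; apply: dz.
- exact: IHL.
Qed.

(** * Path systems and flows in the vertex-split network *)

Section PathSystem.
Variables (n : nat) (N : network n) (bnd : 'I_4 -> pred (vertex N)).
Notation V := (vertex N).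
Notation E := (edge N).
Implicit Types (s : seq E) (x : 'I_4 * seq E) (L : seq ('I_4 * seq E)).

Definition path_verts s : seq V :=
  if s is e :: s' then edge_src e :: map (@edge_dst n N) s else [::].

(** The first component of [x] is the level of the path. [bnd ord0] marks the possible starts and
    [bnd k] the possible ends at level [k]; index 0 is reserved for the starts. *)
Definition good_path x : bool :=
  if x.2 is e :: s' then
    [&& x.1 != ord0, bnd ord0 (edge_src e),
        path (fun e1 e2 => edge_dst e1 == edge_src e2) e s' &
        bnd x.1 (edge_dst (last e s'))]
  else false.

(** Absence of duplicates in the joint vertex list says at once that each path is simple and that
    different paths are vertex-disjoint. *)
Definition path_system L : bool :=
  all good_path L && uniq (flatten [seq path_verts x.2 | x <- L]).

(* The divergence at the level k of the flow of L. *)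
Definition level_excess L (k : 'I_4) : int :=
  if k == ord0 then (size L)%:Z else - (count (fun x => x.1 == k) L)%:Z.

(* The arcs and nodes of the network in which every vertex v is split into an
   arc from (false, v) to (true, v), and where the nodes inr ord0 and inr k are
   the origin of the paths and the destination of the paths of level k. *)
Definition split_arc : finType := (E + V + 'I_4 * V)%type.
Definition split_node : finType := (bool * V + 'I_4)%type.

Definition edge_arc (e : E) : split_arc := inl (inl e).
Definition vertex_arc (v : V) : split_arc := inl (inr v).
Definition level_arc (k : 'I_4) (v : V) : split_arc := inr (k, v).

Definition arc_tail (a : split_arc) : split_node :=
  match a with
  | inl (inl e) => inl (true, edge_src e)
  | inl (inr v) => inl (false, v)
  | inr (k, v) => if k == ord0 then inr ord0 else inl (true, v)
  end.

Definition arc_head (a : split_arc) : split_node :=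
  match a with
  | inl (inl e) => inl (false, edge_dst e)
  | inl (inr v) => inl (true, v)
  | inr (k, v) => if k == ord0 then inl (false, v) else inr k
  end.

(** A projection under which the trail of a path stays over the vertices of that path;
    vertex-disjoint paths therefore have arc-disjoint trails. *)
Definition arc_vertex (a : split_arc) : V :=
  match a with inl (inl e) => edge_dst e | inl (inr v) => v | inr (_, v) => v end.

Definition is_level (y : split_node) : bool := if y is inr _ then true else false.

(** The split network has a level arc for every pair [(k, v)]; this restricts a flow to the genuine
    starts and ends. *)
Definition admissible (F : {set split_arc}) : Prop :=
  forall k v, level_arc k v \in F -> bnd k v.

Notation linked := (path (fun a b => arc_head a == arc_tail b)).

Definition edge_arcs s : seq split_arc :=
  flatten [seq [:: edge_arc e; vertex_arc (edge_dst e)] | e <- s].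

Definition trail x : seq split_arc :=
  if x.2 is e :: s' then
    [:: level_arc ord0 (edge_src e), vertex_arc (edge_src e) &
        edge_arcs x.2 ++ [:: level_arc x.1 (edge_dst (last e s'))]]
  else [::].

Definition flow_of L : {set split_arc} := [set a in flatten (map trail L)].

Lemma linked_edge_arcs a e s k :
  k != ord0 -> arc_head a = inl (true, edge_src e) ->
  path (fun e1 e2 => edge_dst e1 == edge_src e2) e s ->
  linked a (edge_arcs (e :: s) ++ [:: level_arc k (edge_dst (last e s))]).
Proof.
move=> k0; elim: s a e => [|f s IHs] a e /= ae.
  by rewrite ae /= !eqxx (negPf k0) eqxx.
case/andP => ef fs; rewrite ae !eqxx /=.
have := IHs (vertex_arc (edge_dst e)) f; rewrite /= (eqP ef) !eqxx; by apply.
Qed.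

Lemma sum_incidence_trail x y : good_path x ->
  \sum_(a <- trail x) incidence arc_tail arc_head a y =
    (inr ord0 == y)%:Z - (inr x.1 == y)%:Z.
Proof.
case: x => k [|e s] //= /and4P [k0 _ es _].
rewrite /trail; cbv beta iota zeta delta [fst snd].
rewrite sum_incidence_walk.
  by rewrite -cat_cons last_cat /= (negPf k0).
by apply/andP; split; [exact: eqxx | exact: linked_edge_arcs].
Qed.

Lemma mem_edge_arcs a s : a \in edge_arcs s ->
  exists2 e, e \in s & a = edge_arc e \/ a = vertex_arc (edge_dst e).
Proof.
case/flatten_mapP => e es; rewrite !inE => ae; exists e => //.
by case/orP: ae => /eqP; [left | right].
Qed.

Lemma mem_trail_vertex a x : a \in trail x -> arc_vertex a \in path_verts x.2.
Proof.
case: x => k [|e s] //; rewrite /trail; cbv beta iota zeta delta [fst snd].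
have mem_dst f : f \in e :: s -> edge_dst f \in path_verts (e :: s).
  by move=> fs; rewrite inE map_f ?orbT.
move: (@mem_edge_arcs a (e :: s)); move: (edge_arcs _) => t t_mem.
rewrite 2!in_cons mem_cat mem_seq1 => /or4P [/eqP ->|/eqP ->|/t_mem|/eqP ->].
- exact: (mem_head (edge_src e)).
- exact: (mem_head (edge_src e)).
- by case=> f fs [] ->; apply: mem_dst.
- exact/mem_dst/mem_last.
Qed.

Lemma uniq_trail x : good_path x -> uniq (path_verts x.2) -> uniq (trail x).
Proof.
case: x => k [|e s] // /and4P [k0 _ _ _] uv.
have uE t : uniq (map (@edge_dst n N) t) -> uniq (edge_arcs t).
  elim: t => //= f t IHt /andP [ft ut]; rewrite IHt // andbT inE /=.
  by apply/andP; split; apply: contra ft => /mem_edge_arcs [g gt [] // [->]];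
    rewrite map_f.
rewrite /trail; cbv beta iota zeta delta [fst snd].
have /andP [esrc udst] : uniq (edge_src e :: map (@edge_dst n N) (e :: s)) by [].
have := uE (e :: s) udst.
move: (@mem_edge_arcs ^~ (e :: s)); move: (edge_arcs _) => t t_mem ut.
have nolevel j v : level_arc j v \notin t.
  by apply/negP => /t_mem [f _ []].
have novertex : vertex_arc (edge_src e) \notin t.
  apply/negP => /t_mem [f fs [] // [src_f]].
  by rewrite src_f map_f in esrc.
rewrite 2!cons_uniq cat_uniq ut !(inE, mem_cat) !negb_or /=.
rewrite !nolevel novertex /= !andbT.
by apply/eqP => -[k_eq]; rewrite k_eq eqxx in k0.
Qed.

Lemma uniq_flow_arcs L : path_system L -> uniq (flatten (map trail L)).
Proof.
case/andP => /allP Lgood; elim: L Lgood => //= x L IHL Lgood.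
rewrite !cat_uniq => /and3P [ux /hasPn xL uL].
rewrite uniq_trail ?Lgood ?mem_head //= IHL ?andbT //; last first.
  by move=> y yL; apply: Lgood; rewrite inE yL orbT.
apply/hasPn => a /flatten_mapP [y yL /mem_trail_vertex ay].
have /xL : arc_vertex a \in flatten [seq path_verts z.2 | z <- L].
  by apply/flatten_mapP; exists y.
by apply: contra => /mem_trail_vertex.
Qed.

(** No arc occurs twice among the trails, so passing to the set [flow_of L] loses no
    multiplicity. *)
Lemma big_flow_of (T : nmodType)
    (f : split_arc -> T) L : path_system L ->
  \sum_(a in flow_of L) f a =
    \sum_(x <- L) \sum_(a <- trail x) f a.
Proof.
move=> Lsys; rewrite -(big_map _ xpredT (fun t => \sum_(a <- t) f a)).
rewrite -big_flatten /= (big_uniq _ (uniq_flow_arcs Lsys)) /=.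
by apply: eq_bigl => a; rewrite inE.
Qed.

(** Each trail runs from the origin to the node of its level and contributes 1 and -1 at these two
    nodes only. *)
Lemma divergence_flow_of L y : path_system L ->
  divergence arc_tail arc_head (flow_of L) y =
    if y is inr k then level_excess L k else 0.
Proof.
move=> Lsys; rewrite /divergence big_flow_of //.
have /andP [/allP Lgood _] := Lsys.
transitivity (\sum_(x <- L) ((inr ord0 == y)%:Z - (inr x.1 == y)%:Z)).
  rewrite big_seq [RHS]big_seq; apply: eq_bigr => x /Lgood.
  exact: sum_incidence_trail.
(* No trail ends at the origin, so the excess there counts all paths. *)
have {Lsys}: {in L, forall x, x.1 != ord0}.
  by move=> [k [|e s]] /Lgood //= /and4P [].
elim: L {Lgood} => [|x L IHL] L0.
  by rewrite big_nil; case: y => //= k; rewrite /level_excess; case: ifP.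
have x0 := L0 x (mem_head _ _).
rewrite big_cons IHL => [|z zL]; last by apply: L0; rewrite inE zL orbT.
case: y {IHL} => // k.
have inrE (j : 'I_4) : (inr j == inr k :> split_node) = (j == k) by [].
rewrite !inrE /level_excess [size _]/= [count _ (_ :: _)]/= (eq_sym ord0).
by case: (k =P ord0) => [->|_]; rewrite ?(negPf x0) /=; lia.
Qed.

Lemma admissible_flow_of L : path_system L -> admissible (flow_of L).
Proof.
case/andP => /allP Lgood _ k v; rewrite inE => /flatten_mapP [x /Lgood].
case: x => j [|e s] //= /and4P [_ b0 _ bj].
rewrite /trail; cbv beta iota zeta delta [fst snd].
move: (@mem_edge_arcs (level_arc k v) (e :: s)); move: (edge_arcs _) => t t_mem.
rewrite !inE mem_cat mem_seq1 => /or4P [/eqP [-> ->]//|//|/t_mem|/eqP [-> ->]//].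
by case=> f _ [].
Qed.

(** Weights are taken in a commutative monoid because the extended reals, where -∞ has no opposite,
    are not a group. *)
Definition arc_weight (T : nmodType) (w : E -> T) (a : split_arc) : T :=
  if a is inl (inl e) then w e else 0.

Lemma weight_flow_of (T : nmodType)
    (w : E -> T) L : path_system L ->
  \sum_(a in flow_of L) arc_weight w a =
    \sum_(x <- L) \sum_(e <- x.2) w e.
Proof.
move=> Lsys; rewrite big_flow_of //; apply: eq_bigr => -[k [|e s]] _.
  by rewrite /trail !big_nil.
rewrite /trail; cbv beta iota zeta delta [fst snd].
rewrite 2!big_cons big_cat big_seq1 /= !add0r addr0.
elim: (e :: s) => [|f t IHt]; first by rewrite !big_nil.
by rewrite /edge_arcs /= 2!big_cons IHt big_cons /= add0r.
Qed.

Notation incident := (fun e1 e2 => edge_dst e1 == edge_src e2).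

(** The walk is forced to alternate: an outgoing half is left by an edge arc or by a level arc of
    nonzero level, an incoming half only by its vertex arc, and no arc leaves the node of a nonzero
    level. *)
Lemma walk_from_vertex v c :
  linked (vertex_arc v) c -> is_level (arc_head (last (vertex_arc v) c)) ->
  exists s k, [/\ k != ord0,
    if s is e :: s' then (edge_src e == v) && path incident e s' else true &
    c = edge_arcs s ++ [:: level_arc k (last v (map (@edge_dst n N) s))]].
Proof.
have [m] := ubnP (size c); elim: m v c => // m IHm v [|a c] //= le_c.
case/andP => va ac; case: a va ac => [[e|u]|[k u]] //= /eqP; last first.
  case: (k =P ord0) => //= /eqP k0 [<-]; case: c le_c => [|b c] _ //=.
    by move=> _ _; exists [::], k.
  case/andP => /eqP; rewrite (negPf k0) => kb _ _.
  case: b kb => [[]|[j w]] //=; case: eqP => // _ [j0].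
  by rewrite j0 in k0.
case=> -> {v}; case: c le_c => [|b c] //= le_c.
case: b => [[f|u]|[j u]] //=; last by case: ifP.
case/andP => /eqP [<-] bc lc.
have [|s [k [k0 sp c_eq]]] := IHm _ c _ bc lc; first exact: ltnW.
exists (e :: s), k; split=> //=; last by rewrite c_eq.
by rewrite eqxx; case: s sp {c_eq} => //= f s; rewrite eq_sym.
Qed.

(** Among the level nodes only the origin has outgoing arcs, so the walk starts there. It cannot end
    at its first vertex, because starts and ends are disjoint; hence the path read off from it is
    not empty. *)
Lemma terminal_walk_trail c :
  (forall k v, level_arc k v \in c -> bnd k v) ->
  (forall k v, k != ord0 -> bnd k v -> ~~ bnd ord0 v) ->
  terminal_walk arc_tail arc_head is_level c ->
  exists2 x, good_path x & c = trail x.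
Proof.
move=> c_adm bnd0; case: c c_adm => [|a c] //= c_adm /and3P [].
case: a c_adm => [[e|v]|[j v]] //=; case: (j =P ord0) => // -> {j} c_adm _.
case: c c_adm => [|b c] //= c_adm /andP [/eqP vb bc] lc.
have b_eq : b = vertex_arc v.
  by case: b vb {bc lc c_adm} => [[f|u]|[j u]] //=; [case=> -> | case: ifP].
move: c_adm bc lc; rewrite b_eq => c_adm bc lc.
have [s [k [k0 sp c_eq]]] := walk_from_vertex bc lc.
have bv : bnd ord0 v by apply: c_adm; rewrite mem_head.
have bk : bnd k (last v (map (@edge_dst n N) s)).
  by apply: c_adm; rewrite c_eq !inE mem_cat mem_seq1 eqxx !orbT.
case: s sp bk c_eq => [|e s] /=; first by move=> _ /(bnd0 _ _ k0); rewrite bv.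
case/andP => /eqP ev es bk ->; exists (k, e :: s) => /=.
  by rewrite /good_path /= k0 ev bv es -last_map.
by rewrite /trail /= ev last_map.
Qed.

(** This is the purpose of splitting: the vertex arcs of a trail, read in order, list the vertices
    of its path, so distinct arcs give distinct vertices. *)
Lemma uniq_path_verts L : uniq (flatten (map trail L)) ->
  uniq (flatten [seq path_verts x.2 | x <- L]).
Proof.
pose split_vertex (a : split_arc) := if a is inl (inr v) then Some v else None.
have verts_trail x : pmap split_vertex (trail x) = path_verts x.2.
  case: x => k [|e s] //; rewrite /trail; cbv beta iota zeta delta [fst snd].
  rewrite /= pmap_cat /= cats0; congr (_ :: _ :: _).
  by elim: s => //= f s ->.
suff -> : flatten [seq path_verts x.2 | x <- L] =
          pmap split_vertex (flatten (map trail L)).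
  apply: (@pmap_uniq _ _ split_vertex vertex_arc).
  by case=> [[e|v]|kv].
by elim: L => //= x L IHL; rewrite pmap_cat verts_trail IHL.
Qed.

Lemma path_system_of_flow (rank : V -> nat) (F : {set split_arc}) :
  (forall e, rank (edge_src e) < rank (edge_dst e))%N ->
  (forall k v, k != ord0 -> bnd k v -> ~~ bnd ord0 v) ->
  admissible F ->
  (forall b v, divergence arc_tail arc_head F (inl (b, v)) = 0) ->
  exists2 L, path_system L & F = flow_of L.
Proof.
move=> rank_lt bnd0 F_adm F_div.
pose M := \max_(v : V) rank v.
(* Doubling makes room for the two halves of a vertex, the summand 1 keeps them above the origin,
   and their largest value is [M.*2 + 2]. *)
pose node_rank (y : split_node) : nat := match y with
  | inl (b, v) => (rank v).*2 + b + 1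
  | inr k => if k == ord0 then 0 else M.*2 + 3
  end%N.
have [||W Wperm Wwalk] :=
    @walk_decomposition _ _ arc_tail arc_head is_level node_rank F.
- case=> [[e|v]|[k v]] /=; first by have := rank_lt e; lia.
    by lia.
  have : (rank v <= M)%N by exact: leq_bigmax.
  by case: (eqVneq k ord0) => [_|/negPf k0] /=; rewrite ?k0; lia.
- by case=> // -[b v] _; apply: F_div.
have [L Lgood W_eq] : exists2 L, all good_path L & W = map trail L.
  have W_adm k v : level_arc k v \in flatten W -> bnd k v.
    by rewrite -(perm_mem Wperm) mem_enum; apply: F_adm.
  elim: W Wwalk W_adm {Wperm} => [|c W IHW] /=; first by exists [::].
  case/andP => c_walk W_walk W_adm.
  have [k v kv||x xgood ->] := terminal_walk_trail _ _ c_walk => //.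
    by apply: W_adm; rewrite mem_cat kv.
  have [|k v kv|L Lgood ->] := IHW => //.
    by apply: W_adm; rewrite mem_cat kv orbT.
  by exists (x :: L) => //=; rewrite xgood.
exists L; last by apply/setP => a; rewrite inE -W_eq -(perm_mem Wperm) mem_enum.
rewrite /path_system Lgood uniq_path_verts // -W_eq -(perm_uniq Wperm).
exact: enum_uniq.
Qed.

(** The exchanged flows together use each arc as often as the original ones did. This makes their
    level arcs admissible and preserves the total weight. *)
Lemma path_system_exchange (T : nmodType)
    (w : E -> T) (rank : V -> nat) L1 L2 (u v : 'I_4) :
  (forall e, rank (edge_src e) < rank (edge_dst e))%N ->
  (forall k v, k != ord0 -> bnd k v -> ~~ bnd ord0 v) ->
  path_system L1 -> path_system L2 ->
  level_excess L2 u < level_excess L1 u ->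
  (forall k, k != v -> level_excess L2 k <= level_excess L1 k) ->
  exists M1 M2, [/\ path_system M1 /\ path_system M2,
    forall k, level_excess M1 k = level_excess L1 k - (u == k)%:Z + (v == k)%:Z,
    forall k, level_excess M2 k = level_excess L2 k + (u == k)%:Z - (v == k)%:Z &
    \sum_(x <- L1) \sum_(e <- x.2) w e + \sum_(x <- L2) \sum_(e <- x.2) w e =
    \sum_(x <- M1) \sum_(e <- x.2) w e + \sum_(x <- M2) \sum_(e <- x.2) w e].
Proof.
move=> rank_lt bnd0 L1sys L2sys lt_u le_v.
have [||F1 [F2 [memF F1div F2div]]] :=
    @flow_exchange _ _ arc_tail arc_head (flow_of L1) (flow_of L2)
      (inr u) (inr v).
- by rewrite !divergence_flow_of.
- by move=> [[b y]|k] kv; rewrite !divergence_flow_of //; exact: le_v.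
have adm (F : {set split_arc}) :
    (forall a, a \in F -> (a \in flow_of L1) || (a \in flow_of L2)) ->
    admissible F.
  by move=> FL k y /FL /orP [] /admissible_flow_of; apply.
have [||M1 M1sys F1_eq] := @path_system_of_flow rank F1 rank_lt bnd0.
- by apply: adm => a aF; have := memF a; rewrite aF;
    case: (a \in flow_of L1); case: (a \in flow_of L2).
- by move=> b y; rewrite F1div divergence_flow_of.
have [||M2 M2sys F2_eq] := @path_system_of_flow rank F2 rank_lt bnd0.
- by apply: adm => a aF; have := memF a; rewrite aF addnC;
    case: (a \in flow_of L1); case: (a \in flow_of L2).
- by move=> b y; rewrite F2div divergence_flow_of.
exists M1, M2; split=> // [k|k|].
- by have := F1div (inr k); rewrite F1_eq !divergence_flow_of.
- by have := F2div (inr k); rewrite F2_eq !divergence_flow_of.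
(* The weights are compared arc by arc, without subtraction. *)
rewrite -!weight_flow_of // -F1_eq -F2_eq.
rewrite !(big_mkcond (fun a => a \in _)) -!big_split; apply: eq_bigr => a _ /=.
have := memF a; case: (a \in F1); case: (a \in F2);
  case: (a \in flow_of L1); case: (a \in flow_of L2) => // _;
  by rewrite ?addr0 ?add0r.
Qed.

End PathSystem.

(** * Permutation and concatenation of path systems *)

Section PathSystemPerm.
Variables (n : nat) (N : network n) (bnd : 'I_4 -> pred (vertex N)).
Implicit Types (L : seq ('I_4 * seq (edge N))).

Lemma perm_path_system L1 L2 :
  perm_eq L1 L2 -> path_system bnd L1 = path_system bnd L2.
Proof.
move=> L12; rewrite /path_system (perm_all _ L12); congr (_ && _).
by apply/perm_uniq/perm_flatten/perm_map.
Qed.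

Lemma perm_level_excess L1 L2 k :
  perm_eq L1 L2 -> level_excess L1 k = level_excess L2 k.
Proof. by move=> L12; rewrite /level_excess (perm_size L12) (permP L12). Qed.

Lemma path_system_cat L1 L2 : path_system bnd (L1 ++ L2) =
  [&& path_system bnd L1, path_system bnd L2 &
      ~~ has (mem (flatten [seq path_verts x.2 | x <- L1]))
             (flatten [seq path_verts x.2 | x <- L2])].
Proof.
rewrite /path_system all_cat map_cat flatten_cat cat_uniq.
by case: (all _ L1); case: (all _ L2); case: (uniq _); case: (has _ _);
  case: (uniq _).
Qed.

(** Good paths are nonempty, so a repeated path would repeat its first vertex. *)
Lemma path_system_uniq L : path_system bnd L -> uniq L.
Proof.
case/andP; elim: L => //= x L IHL /andP [xgood Lgood].
rewrite cat_uniq => /and3P [_ /hasPn xL uL]; rewrite IHL // andbT.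
apply/negP => xinL; case: x xgood xL xinL => k [|e s] //= _ xL xinL.
have /xL : edge_src e \in flatten [seq path_verts x.2 | x <- L].
  by apply/flatten_mapP; exists (k, e :: s); rewrite // mem_head.
by rewrite inE eqxx.
Qed.

(** Ranks increase strictly along the path. *)
Lemma uniq_good_path_verts (rank : vertex N -> nat) x :
  (forall e, rank (edge_src e) < rank (edge_dst e))%N ->
  good_path bnd x -> uniq (path_verts x.2).
Proof.
move=> rank_lt; case: x => k [|e s] // /and4P [_ _ es _].
apply: (@sorted_uniq _ (relpre rank ltn)).
- by move=> u v w; apply: ltn_trans.
- by move=> u; apply: ltnn.
rewrite /= rank_lt /=; move: es; cbv beta iota zeta delta [fst snd].
by elim: s e => //= f s IHs e /andP [/eqP -> /IHs ->]; rewrite rank_lt.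
Qed.

End PathSystemPerm.

(** * Multipaths of an embedded network as blocks of a path system *)

Section EmbeddedMultipath.
Variables (n : nat) (M N : network n).
Variables (fE : edge M -> edge N) (fV : vertex M -> vertex N).
Variables (bnd : 'I_4 -> pred (vertex N)) (k : 'I_4) (rank : vertex N -> nat).
Hypothesis fE_inj : injective fE.
Hypothesis fV_inj : injective fV.
Hypothesis src_fE : forall e, edge_src (fE e) = fV (edge_src e).
Hypothesis dst_fE : forall e, edge_dst (fE e) = fV (edge_dst e).
Hypothesis bnd0 : forall v, bnd ord0 (fV v) = (v \in codom (source M)).
Hypothesis bndk : forall v, bnd k (fV v) = (v \in codom (sink M)).
Hypothesis k_neq0 : k != ord0.
Hypothesis rank_lt : forall e : edge N, (rank (edge_src e) < rank (edge_dst e))%N.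
Hypothesis lift_path : forall e s,
  path (fun e1 e2 : edge N => edge_dst e1 == edge_src e2) e s ->
  bnd k (edge_dst (last e s)) -> exists q, e :: s = map fE q.

(** [M] will be each of the three partial concatenations in turn, embedded in the whole one [N],
    with its own level [k]. *)
Definition multipath_block (P : {set edge_seq M}) : seq ('I_4 * seq (edge N)) :=
  [seq (k, map fE (val q)) | q <- enum P].

Lemma good_path_map (q : seq (edge M)) :
  good_path bnd (k, map fE q) = is_path q.
Proof.
case: q => //= e s.
rewrite /good_path /= k_neq0 src_fE bnd0 last_map dst_fE bndk /=.
congr [&& _, _ & _]; rewrite path_map; apply: eq_path => e1 e2 /=.
by rewrite dst_fE src_fE (inj_eq fV_inj).
Qed.

Lemma path_verts_map (q : seq (edge M)) :
  path_verts (map fE q) = map fV (path_verts q).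
Proof.
case: q => //= e s; rewrite src_fE dst_fE -!map_comp; congr [:: _, _ & _].
by apply: eq_map => f /=; rewrite dst_fE.
Qed.

(** On a path the start of every edge but the first is the end of the preceding edge. *)
Lemma mem_path_vertices (q : seq (edge M)) v : is_path q ->
  (v \in path_vertices q) = (v \in path_verts q).
Proof.
case: q => // e s /and3P [_ es _].
rewrite inE mem_cat [path_verts _]/= -map_cons [RHS]in_cons orbC.
case: (boolP (v \in map (@edge_dst n M) _)) => [_|vd]; first by rewrite orbT.
rewrite orbF map_cons in_cons; case: (v =P edge_src e) => //= _.
elim: s e es vd => // f s IHs e /andP [/eqP ef fs].
rewrite map_cons in_cons negb_or => /andP [/negPf ve vd].
by rewrite map_cons in_cons -ef ve; exact: (IHs f fs vd).
Qed.

Lemma multipath_block_uniq P : uniq (multipath_block P).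
Proof.
rewrite map_inj_uniq ?enum_uniq // => q1 q2 [] /(inj_map fE_inj).
exact: val_inj.
Qed.

(** [is_multipath] compares distinct paths only; that a single path does not meet itself, as
    [path_system] also demands, comes from the rank. *)
Lemma is_multipath_block a (P : {set edge_seq M}) :
  is_multipath a P =
  (size (multipath_block P) == a) && path_system bnd (multipath_block P).
Proof.
rewrite /is_multipath size_map -cardE; congr (_ && _).
apply/andP/andP => -[].
  move=> /forall_inP Ppath /forall_inP Pdisj; split.
    apply/allP => x /mapP [q]; rewrite mem_enum => /Ppath qpath ->.
    by rewrite good_path_map.
  apply: uniq_flatten_map.
  - exact: multipath_block_uniq.
  - move=> x /mapP [q]; rewrite mem_enum => /Ppath qpath ->.
    by apply: (uniq_good_path_verts (bnd := bnd) rank_lt); rewrite good_path_map.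
  move=> x y /mapP [q + ->] /mapP [r + ->] qr; rewrite !mem_enum => qP rP.
  have /forall_inP/(_ r rP)/implyP qr_disj := Pdisj q qP.
  have {}qr : q != r by apply: contraNneq qr => ->.
  apply/hasPn => v; rewrite /= !path_verts_map => /mapP [u ur ->].
  rewrite /= mem_map //; move: ur; rewrite -!mem_path_vertices ?Ppath // => ur.
  by rewrite (disjointFl (qr_disj qr) ur).
move=> /allP Pgood Pu.
have Ppath q : q \in P -> is_path (val q).
  by move=> qP; rewrite -good_path_map; apply/Pgood/map_f; rewrite mem_enum.
split; first by apply/forall_inP.
apply/forall_inP => q qP; apply/forall_inP => r rP; apply/implyP => qr.
have := uniq_flatten_map_disjoint Pu
  (x := (k, map fE (val q))) (y := (k, map fE (val r))).
rewrite !map_f ?mem_enum // => /(_ isT isT).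
have -> : (k, map fE (val q)) != (k, map fE (val r)).
  by apply: contra qr => /eqP [] /(inj_map fE_inj) /val_inj ->.
move=> /(_ isT) /hasPn qr_disj; apply/pred0P => v /=.
rewrite !mem_path_vertices ?Ppath //; apply/negP => /andP [vq vr].
have /qr_disj : fV v \in path_verts (map fE (val r)).
  by rewrite path_verts_map map_f.
by rewrite /= path_verts_map map_f.
Qed.

Lemma mem_multipath_vertices (P : {set edge_seq M}) v :
  path_system bnd (multipath_block P) ->
  (v \in [set fV u | u in multipath_vertices P]) =
  (v \in flatten [seq path_verts x.2 | x <- multipath_block P]).
Proof.
case/andP => /allP Pgood _.
have Ppath q : q \in P -> is_path (val q).
  by move=> qP; rewrite -good_path_map; apply/Pgood/map_f; rewrite mem_enum.
apply/imsetP/flatten_mapP => [[u /bigcupP [q qP]]|[x /mapP [q]]].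
  rewrite mem_path_vertices ?Ppath // => uq ->.
  exists (k, map fE (val q)); first by rewrite map_f ?mem_enum.
  by rewrite path_verts_map map_f.
rewrite mem_enum => qP ->; rewrite path_verts_map => /mapP [u uq ->].
by exists u => //; apply/bigcupP; exists q; rewrite ?mem_path_vertices ?Ppath.
Qed.

Lemma multipath_block_exists (L : seq ('I_4 * seq (edge N))) :
  all (good_path bnd) L -> exists P : {set edge_seq M},
  forall x, (x \in multipath_block P) = (x \in L) && (x.1 == k).
Proof.
move=> /allP Lgood; exists [set q | (k, map fE (val q)) \in L] => -[j s] /=.
apply/mapP/andP => [[q]|[jsL /eqP jk]].
  by rewrite mem_enum inE => qL [-> ->].
rewrite jk in jsL *; have := Lgood _ jsL.
case: s jsL => [|e s] // esL es_good; have /and4P [_ _ es_path es_bnd] := es_good.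
have [q q_eq] := lift_path es_path es_bnd.
(* The path repeats no vertex, hence no edge, and so fits into the bounded type [edge_seq]. *)
have size_q : (size q <= #|edge M|)%N.
  have : uniq (path_verts (map fE q)).
    by rewrite -q_eq; exact: (uniq_good_path_verts rank_lt es_good).
  rewrite path_verts_map (map_inj_uniq fV_inj) => uq.
  have {}uq : uniq q.
    case: q uq {q_eq} => // f q /andP [_ uq].
    exact: (@map_uniq _ _ (@edge_dst n M) (f :: q) uq).
  by rewrite -(card_uniqP uq) max_card.
exists (Bseq size_q); last by rewrite q_eq.
by rewrite mem_enum inE /= -q_eq.
Qed.

End EmbeddedMultipath.

(** * Rank functions on networks and their concatenations *)

Section Layered.
Variable n : nat.

(** An integer substitute for the abscissa; this is all that the argument takes from the planar
    drawing. *)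
Record layered (N : network n) (rk : vertex N -> nat) (h : nat) : Prop :=
  Layered {
    height_gt0 : (0 < h)%N;
    rank_le_height : forall v, (rk v <= h)%N;
    rank_source : forall i, rk (source N i) = 0;
    rank_sink : forall i, rk (sink N i) = h;
    rank_edge : forall e, (rk (edge_src e) < rk (edge_dst e))%N }.

Variables (M N : network n) (rkM : vertex M -> nat) (rkN : vertex N -> nat).
Variables (hM hN : nat).
Hypothesis M_layered : layered rkM hM.
Hypothesis N_layered : layered rkN hN.

Definition concat_rank (v : vertex (concat M N)) : nat :=
  match v with inl u => rkM u | inr u => hM + rkN (val u) end.

(** At a glued vertex the two descriptions agree, since sinks of [M] have rank [hM] and sources of
    [N] rank 0. *)
Lemma concat_rank_glue v : concat_rank (concat_glue M v) = (hM + rkN v)%N.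
Proof.
rewrite /concat_glue; case: pickP => [i /eqP <-|] //=.
by rewrite (rank_source N_layered) (rank_sink M_layered) addn0.
Qed.

Lemma concat_layered : layered concat_rank (hM + hN).
Proof.
split.
- by rewrite addn_gt0 (height_gt0 M_layered).
- case=> [v|v] /=.
    by rewrite (leq_trans (rank_le_height M_layered v)) ?leq_addr.
  by rewrite leq_add2l (rank_le_height N_layered).
- exact: (rank_source M_layered).
- by move=> i; rewrite concat_rank_glue (rank_sink N_layered).
- case=> e /=; first exact: (rank_edge M_layered).
  by rewrite !concat_rank_glue ltn_add2l (rank_edge N_layered).
Qed.

(** An edge of [N] ends at a rank above [hM], which no vertex of [M] exceeds. *)
Lemma concat_edge_inl (e : edge (concat M N)) (v : vertex M) :
  edge_dst e = inl v -> exists f : edge M, e = inl f.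
Proof.
case: e => [f|f] /= fv; first by exists f.
have := concat_rank_glue (edge_dst f); rewrite fv /= => rkv.
have := rank_le_height M_layered v; have := rank_edge N_layered f; lia.
Qed.

Lemma concat_path_inl (e : edge (concat M N)) s (v : vertex M) :
  path (fun e1 e2 => edge_dst e1 == edge_src e2) e s ->
  edge_dst (last e s) = inl v ->
  exists q : seq (edge M), e :: s = map inl q.
Proof.
elim: s e => [|f s IHs] e /=.
  by move=> _ /concat_edge_inl [f ->]; exists [:: f].
case/andP => /eqP ef fs sv; have [[|g q] //] := IHs f fs sv.
case=> fg sq; rewrite fg /= in ef.
have [e1 ->] := concat_edge_inl ef.
by exists [:: e1, g & q]; rewrite fg sq.
Qed.

End Layered.

(** * Triples of multipaths as path systems in the triple concatenation *)

Section Multipath3System.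
Variables (n : nat) (N1 N2 N3 : network n).
Variables (rk1 : vertex N1 -> nat) (rk2 : vertex N2 -> nat).
Variables (rk3 : vertex N3 -> nat).
Variables (h1 h2 h3 : nat).
Hypothesis N1_layered : layered rk1 h1.
Hypothesis N2_layered : layered rk2 h2.
Hypothesis N3_layered : layered rk3 h3.
Notation N12 := (concat N1 N2).
Notation N123 := (concat N12 N3).

Definition rank12 := @concat_rank n N1 N2 rk1 rk2 h1.
Definition rank123 := @concat_rank n N12 N3 rank12 rk3 (h1 + h2).

Lemma layered12 : layered rank12 (h1 + h2).
Proof. exact: concat_layered. Qed.

Lemma layered123 : layered rank123 (h1 + h2 + h3).
Proof. exact: concat_layered layered12 N3_layered. Qed.

Definition edge1 (e : edge N1) : edge N123 := inl (inl e).
Definition edge2 (e : edge N12) : edge N123 := inl e.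
Definition edge3 (e : edge N123) : edge N123 := e.
Definition vertex1 (v : vertex N1) : vertex N123 :=
  concat_inl N3 (concat_inl N2 v).
Definition vertex2 (v : vertex N12) : vertex N123 := concat_inl N3 v.
Definition vertex3 (v : vertex N123) : vertex N123 := v.

Definition bnd123 (k : 'I_4) : pred (vertex N123) :=
  match val k with
  | 0 => mem (codom (source N123))
  | 1 => mem (codom (vertex1 \o sink N1))
  | 2 => mem (codom (vertex2 \o sink N12))
  | _ => mem (codom (sink N123))
  end%N.

(** Sources have rank 0, while the sinks of every partial concatenation have positive rank. *)
Lemma bnd123_source k v : k != ord0 -> bnd123 k v -> ~~ bnd123 ord0 v.
Proof.
move=> k0 kv; apply/negP => /codomP [i v_i].
have := rank_source layered123 i; rewrite -v_i.
suff : (0 < rank123 v)%N by lia.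
have h1_gt0 := height_gt0 N1_layered.
move: k k0 kv {i v_i} => [[|[|[|[|//]]]] lt4] // _ /codomP [i ->].
- by rewrite [rank123 _](rank_sink N1_layered); lia.
- by rewrite [rank123 _](rank_sink layered12); lia.
- by rewrite (rank_sink layered123); lia.
Qed.

Let rank_lt := rank_edge layered123.

Lemma codom_comp_inj (A B : eqType) (f : 'I_n -> A) (g : A -> B) v :
  injective g -> (g v \in codom (g \o f)) = (v \in codom f).
Proof.
by move=> g_inj; rewrite /codom /image_mem map_comp mem_map.
Qed.

Definition multipath3_system (p : multipath3 N1 N2 N3) :
    seq ('I_4 * seq (edge N123)) :=
  let: (p1, p2, p3) := p in
  multipath_block edge1 (inord 1) p1 ++
  (multipath_block edge2 (inord 2) p2 ++ multipath_block edge3 (inord 3) p3).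

Lemma edge1_inj : injective edge1. Proof. by move=> e f []. Qed.
Lemma edge2_inj : injective edge2. Proof. by move=> e f []. Qed.
Lemma edge3_inj : injective edge3. Proof. by []. Qed.
Lemma vertex1_inj : injective vertex1. Proof. by move=> e f []. Qed.
Lemma vertex2_inj : injective vertex2. Proof. by move=> e f []. Qed.
Lemma vertex3_inj : injective vertex3. Proof. by []. Qed.

Lemma inord_neq0 j : (0 < j < 4)%N -> (inord j : 'I_4) != ord0.
Proof.
by case/andP => j_gt0 j_lt4; rewrite -val_eqE /= inordK // -lt0n.
Qed.

Lemma source1 v : bnd123 ord0 (vertex1 v) = (v \in codom (source N1)).
Proof. exact: (codom_comp_inj _ _ vertex1_inj). Qed.

Lemma source2 v : bnd123 ord0 (vertex2 v) = (v \in codom (source N12)).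
Proof. exact: (codom_comp_inj _ _ vertex2_inj). Qed.

Lemma sink1 v : bnd123 (inord 1) (vertex1 v) = (v \in codom (sink N1)).
Proof.
by rewrite /bnd123 /= inordK //; exact: (codom_comp_inj _ _ vertex1_inj).
Qed.

Lemma sink2 v : bnd123 (inord 2) (vertex2 v) = (v \in codom (sink N12)).
Proof.
by rewrite /bnd123 /= inordK //; exact: (codom_comp_inj _ _ vertex2_inj).
Qed.

Lemma sink3 v : bnd123 (inord 3) (vertex3 v) = (v \in codom (sink N123)).
Proof. by rewrite /bnd123 /= inordK. Qed.

Notation incident := (fun e1 e2 => edge_dst e1 == edge_src e2).

Lemma lift2 (e : edge N123) s v : path incident e s ->
  edge_dst (last e s) = vertex2 v -> exists q, e :: s = map edge2 q.
Proof. exact: (concat_path_inl layered12 N3_layered). Qed.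

Lemma lift_path2 (e : edge N123) s : path incident e s ->
  bnd123 (inord 2) (edge_dst (last e s)) -> exists q, e :: s = map edge2 q.
Proof.
by move=> es; rewrite /bnd123 /= inordK // => /codomP [i /(lift2 es)].
Qed.

(** The path is first confined to [N12], then to [N1], each time because of where it ends. *)
Lemma lift_path1 (e : edge N123) s : path incident e s ->
  bnd123 (inord 1) (edge_dst (last e s)) -> exists q, e :: s = map edge1 q.
Proof.
move=> es; rewrite /bnd123 /= inordK // => /codomP [i ei].
have [[|f q] // [ef sq]] := lift2 es ei.
have [] := @concat_path_inl n N1 N2 rk1 rk2 h1 h2 N1_layered N2_layered
  f q (sink N1 i).
- by move: es; rewrite ef sq path_map; congr is_true; exact: eq_path.
- by move: ei; rewrite ef sq last_map => -[].
by move=> r r_eq; exists r; rewrite ef sq -(map_cons edge2) r_eq -map_comp.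
Qed.

Lemma lift_path3 (e : edge N123) s : path incident e s ->
  bnd123 (inord 3) (edge_dst (last e s)) -> exists q, e :: s = map edge3 q.
Proof. by move=> _ _; exists (e :: s); rewrite map_id. Qed.

Let k1 := inord_neq0 (isT : 0 < 1 < 4)%N.
Let k2 := inord_neq0 (isT : 0 < 2 < 4)%N.
Let k3 := inord_neq0 (isT : 0 < 3 < 4)%N.

Let is_multipath_block1 := is_multipath_block edge1_inj vertex1_inj
  (fun=> erefl) (fun=> erefl) source1 sink1 k1 rank_lt.
Let is_multipath_block2 := is_multipath_block edge2_inj vertex2_inj
  (fun=> erefl) (fun=> erefl) source2 sink2 k2 rank_lt.
Let is_multipath_block3 := is_multipath_block edge3_inj vertex3_inj
  (fun=> erefl) (fun=> erefl) (fun=> erefl) sink3 k3 rank_lt.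

Let mem_vertices1 := mem_multipath_vertices (fE := edge1) vertex1_inj
  (fun=> erefl) (fun=> erefl) source1 sink1 k1.
Let mem_vertices2 := mem_multipath_vertices (fE := edge2) vertex2_inj
  (fun=> erefl) (fun=> erefl) source2 sink2 k2.
Let mem_vertices3 := mem_multipath_vertices (fE := edge3) vertex3_inj
  (fun=> erefl) (fun=> erefl) (fun=> erefl) sink3 k3.

Lemma disjoint_has (T : finType) (A B : {set T}) (s t : seq T) :
  A =i s -> B =i t -> [disjoint A & B] = ~~ has (mem s) t.
Proof.
move=> As Bt; rewrite disjoint_sym (eq_disjoint Bt) disjoint_has.
by congr (~~ _); apply: eq_has => v /=; rewrite As.
Qed.

(** Disjointness of the three vertex sets is the part of [path_system] that compares different
    blocks. *)
Lemma is_multipath3E (a1 a2 a3 : nat) p1 p2 p3 :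
  is_multipath3 (a1, a2, a3) (p1, p2, p3) =
  [&& path_system bnd123 (multipath3_system (p1, p2, p3)),
      size (multipath_block edge1 (inord 1) p1) == a1,
      size (multipath_block edge2 (inord 2) p2) == a2 &
      size (multipath_block edge3 (inord 3) p3) == a3].
Proof.
rewrite /is_multipath3 is_multipath_block1 is_multipath_block2 is_multipath_block3.
rewrite /multipath3_system !path_system_cat map_cat flatten_cat has_cat negb_or.
have [s1|_] := boolP (path_system _ (multipath_block edge1 _ _));
  last by rewrite !andbF.
have [s2|_] := boolP (path_system _ (multipath_block edge2 _ _));
  last by rewrite !andbF.
have [s3|_] := boolP (path_system _ (multipath_block edge3 _ _));
  last by rewrite !andbF.
have m1 := @mem_vertices1 p1 ^~ s1.
have m2 := @mem_vertices2 p2 ^~ s2.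
have m3 v := @mem_vertices3 p3 v s3.
rewrite imset_id in m3.
rewrite (disjoint_has m1 m2) (disjoint_has m1 m3) (disjoint_has m2 m3).
rewrite !andbT /=; do 3 case: (size _ == _); rewrite ?andbF ?andbT //=.
by do 3 case: (has _ _).
Qed.

Lemma count_multipath_block (M : network n) (f : edge M -> edge N123) k j P :
  count (fun x => x.1 == j) (multipath_block f k P) =
    ((k == j) * size (multipath_block f k P))%N.
Proof.
rewrite /multipath_block count_map size_map.
case: (k =P j) => [->|kj] /=; last first.
  rewrite mul0n; apply/eqP; rewrite -leqn0 leqNgt -has_count.
  by apply/hasPn => q _ /=; apply/eqP.
by rewrite mul1n -count_predT; apply: eq_count => q /=; rewrite eqxx.
Qed.

Lemma level_excess_multipath3 (a1 a2 a3 : nat) p k :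
  is_multipath3 (a1, a2, a3) p ->
  level_excess (multipath3_system p) k =
    nth 0 [:: (a1 + a2 + a3)%:Z; - a1%:Z; - a2%:Z; - a3%:Z] k.
Proof.
case: p => [[p1 p2] p3].
rewrite is_multipath3E => /and4P [_ /eqP <- /eqP <- /eqP <-].
rewrite /level_excess /multipath3_system !size_cat !count_cat.
rewrite !count_multipath_block.
rewrite -!val_eqE /= !inordK //.
by case: k => [[|[|[|[|//]]]] lt4] /=; lia.
Qed.

(** The paths are sorted by level, which is 1, 2 or 3; their order in [L] is lost, whence the
    permutation. *)
Lemma multipath3_of_system L : path_system bnd123 L ->
  exists p, perm_eq L (multipath3_system p).
Proof.
move=> Lsys; have /andP [Lgood _] := Lsys.
have [p1 p1L] := multipath_block_exists (fE := edge1) vertex1_inj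
  (fun=> erefl) (fun=> erefl) rank_lt lift_path1 Lgood.
have [p2 p2L] := multipath_block_exists (fE := edge2) vertex2_inj
  (fun=> erefl) (fun=> erefl) rank_lt lift_path2 Lgood.
have [p3 p3L] := multipath_block_exists (fE := edge3) vertex3_inj
  (fun=> erefl) (fun=> erefl) rank_lt lift_path3 Lgood.
exists (p1, p2, p3); apply: uniq_perm; first exact: path_system_uniq Lsys.
  rewrite /multipath3_system !cat_uniq has_cat negb_or.
  rewrite (multipath_block_uniq _ edge1_inj) (multipath_block_uniq _ edge2_inj).
  rewrite (multipath_block_uniq _ edge3_inj) /= andbT.
  rewrite -andbA; apply/and3P; split; apply/hasPn => x;
    rewrite /= ?p1L ?p2L ?p3L => /andP [_ /eqP ->];
    by rewrite -val_eqE /= !inordK // andbF.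
move=> x; rewrite /multipath3_system !mem_cat p1L p2L p3L.
case xL: (x \in L) => //=; have := allP Lgood x xL.
case: x {xL} => k [|e s] //= /and4P [k0 _ _ _]; rewrite -!val_eqE /= !inordK //.
by case: k k0 => [[|[|[|[|//]]]] lt4].
Qed.

Lemma level_excess_is_multipath3 p (a1 a2 a3 : nat) :
  path_system bnd123 (multipath3_system p) ->
  level_excess (multipath3_system p) (inord 1) = - a1%:Z ->
  level_excess (multipath3_system p) (inord 2) = - a2%:Z ->
  level_excess (multipath3_system p) (inord 3) = - a3%:Z ->
  is_multipath3 (a1, a2, a3) p.
Proof.
case: p => [[p1 p2] p3] sys; rewrite is_multipath3E sys /= /level_excess.
rewrite (negPf k1) (negPf k2) (negPf k3).
rewrite !count_cat !count_multipath_block.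
rewrite -!val_eqE /= !inordK //=; lia.
Qed.

End Multipath3System.

From mathcomp Require Import all_classical reals ereal topology normedtype.

(** * The rank given by a planar embedding *)

Section Planar.
Variables (R : realType) (n : nat).

(** The number of vertices further left increases along edges. The extra unit at positive abscissas
    makes the height positive even if no vertex lies to the left of the sinks' line, as can happen
    for [n = 0]. *)
Definition planar_rank (N : network n) (emb : planar_embedding R N)
    (v : vertex N) : nat :=
  (#|[pred u | (px emb u < px emb v)%R]| + (0 < px emb v)%R)%N.

Lemma planar_layered (N : network n) (emb : planar_embedding R N) :
  layered (planar_rank emb) #|[pred u | px emb u < width emb]|.+1.
Proof.
have width0 := width_gt0 emb.
split=> // [v|i|i|e].
- rewrite -addn1 leq_add ?leq_b1 //; apply/subset_leq_card/fintype.subsetP => u.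
  by rewrite !inE => /lt_le_trans; apply; have /andP [] := in_strip emb v.
- rewrite /planar_rank source_px ltxx addn0; apply: eq_card0 => u.
  by rewrite !inE ltNge; have /andP [-> _] := in_strip emb u.
- by rewrite /planar_rank sink_px width0 addn1.
- have e_lt := left_to_right emb e.
  rewrite /planar_rank -addSn leq_add //.
    apply/proper_card/properP; split.
      by apply/fintype.subsetP => u; rewrite !inE => /lt_trans; apply.
    by exists (edge_src e); rewrite !inE ?ltxx.
  by case: ltP => // src_gt0; rewrite (lt_trans src_gt0 e_lt).
Qed.

End Planar.

(** * The exchange inequality for maximal weights *)

Section MaxWeight.
Variables (R : realType) (n : nat) (N1 N2 N3 : network n).
Variables (w1 : edge N1 -> \bar R) (w2 : edge N2 -> \bar R)
          (w3 : edge N3 -> \bar R).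

Lemma max_weight_attained alpha :
  max_weight w1 w2 w3 alpha = -oo%E \/
  exists2 p, is_multipath3 alpha p &
    max_weight w1 w2 w3 alpha = multipath3_weight w1 w2 w3 p.
Proof.
rewrite /max_weight; elim/big_rec: _ => [|p x p_alpha IH]; first by left.
by case: leP => // _; right; exists p.
Qed.

Lemma max_weight_ge alpha p : is_multipath3 alpha p ->
  (multipath3_weight w1 w2 w3 p <= max_weight w1 w2 w3 alpha)%E.
Proof.
move=> p_alpha.
exact: (le_bigmax_cond -oo%E (multipath3_weight w1 w2 w3) p_alpha).
Qed.

Lemma weight_multipath3_system (p : multipath3 N1 N2 N3) :
  (\sum_(x <- multipath3_system p)
     \sum_(e <- x.2) concat_weight (concat_weight w1 w2) w3 e)%E =
  multipath3_weight w1 w2 w3 p.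
Proof.
case: p => [[p1 p2] p3]; rewrite /multipath3_system !big_cat /=.
rewrite addeA; congr (_ + _ + _)%E; rewrite /multipath_weight big_map big_enum;
  by apply: eq_bigr => s _; rewrite big_map.
Qed.

Variables (rk1 : vertex N1 -> nat) (rk2 : vertex N2 -> nat).
Variables (rk3 : vertex N3 -> nat).
Variables (h1 h2 h3 : nat).
Hypothesis N1_layered : layered rk1 h1.
Hypothesis N2_layered : layered rk2 h2.
Hypothesis N3_layered : layered rk3 h3.

(** The number of paths is [n] minus the coordinate 0. Up to a constant, the excess is thus minus
    the coordinate at all four levels alike, so the symmetry of small rhombi costs no case
    distinction. *)
Lemma level_excess_drop_x0 (x : 'I_4 -> nat) (p : multipath3 N1 N2 N3) k :
  (\sum_i x i)%N = n -> is_multipath3 (drop_x0 x) p ->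
  level_excess (multipath3_system p) k = (k == ord0)%:Z * n%:Z - (x k)%:Z.
Proof.
move=> sum_x x_p.
rewrite (level_excess_multipath3 N1_layered N2_layered N3_layered k x_p).
have x_inord j (j_lt4 : (j < 4)%N) : x (inord j) = x (Ordinal j_lt4).
  by congr x; apply: val_inj; rewrite /= inordK.
have {}sum_x : (x ord0 + (x (inord 1) + (x (inord 2) + x (inord 3))) = n)%N.
  rewrite -sum_x !big_ord_recl big_ord0 addn0 !x_inord.
  by do !congr (_ + _)%N; congr x; apply: val_inj.
case: k => [[|[|[|[|//]]]] lt4]; rewrite -val_eqE /= -x_inord ?mul0r ?sub0r //.
have -> : inord 0 = ord0 :> 'I_4 by apply: val_inj; rewrite /= inordK.
by lia.
Qed.

(** The excess decreases with the coordinate: the flow for [x] exceeds the one for [z] at [u] and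
    can fall short of it only at [v]. Moving one unit raises [x] at [u] and lowers it at [v], and
    does the opposite to [z]. *)
Lemma max_weight_exchange (x z x' z' : 'I_4 -> nat) (u v : 'I_4) :
  (\sum_i x i)%N = n -> (\sum_i z i)%N = n ->
  (x u < z u)%N -> (forall k, k != v -> (x k <= z k)%N) ->
  (forall k, (x' k + (k == v) = x k + (k == u))%N) ->
  (forall k, (z' k + (k == u) = z k + (k == v))%N) ->
  (max_weight w1 w2 w3 (drop_x0 x) + max_weight w1 w2 w3 (drop_x0 z) <=
   max_weight w1 w2 w3 (drop_x0 x') + max_weight w1 w2 w3 (drop_x0 z'))%E.
Proof.
move=> sum_x sum_z lt_u le_v x'_eq z'_eq.
(* If one of the two maxima is -∞, so is the left-hand side, since -∞ absorbs every summand. *)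
have [->|[p x_p ->]] := max_weight_attained (drop_x0 x).
  by rewrite addNye leNye.
have [->|[q z_q ->]] := max_weight_attained (drop_x0 z).
  by rewrite addeNy leNye.
have p_exc k := level_excess_drop_x0 k sum_x x_p.
have q_exc k := level_excess_drop_x0 k sum_z z_q.
have p_sys : path_system (@bnd123 _ N1 N2 N3) (multipath3_system p).
  move: x_p {p_exc}; case: p => [[p1 p2] p3].
  by rewrite /drop_x0 (is_multipath3E N1_layered N2_layered N3_layered) => /andP [].
have q_sys : path_system (@bnd123 _ N1 N2 N3) (multipath3_system q).
  move: z_q {q_exc}; case: q => [[q1 q2] q3].
  by rewrite /drop_x0 (is_multipath3E N1_layered N2_layered N3_layered) => /andP [].
have rank_lt := rank_edge (layered123 N1_layered N2_layered N3_layered).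
have [||L [M [[L_sys M_sys] L_exc M_exc LM_weight]]] := path_system_exchange
  (concat_weight (concat_weight w1 w2) w3) (u := u) (v := v) rank_lt
  (bnd123_source N1_layered N2_layered N3_layered) p_sys q_sys.
- by rewrite p_exc q_exc; lia.
- by move=> k /le_v; rewrite p_exc q_exc; lia.
have [p' Lp'] := multipath3_of_system N1_layered N2_layered N3_layered L_sys.
have [q' Mq'] := multipath3_of_system N1_layered N2_layered N3_layered M_sys.
have L_x' k : k != ord0 -> level_excess (multipath3_system p') k = - (x' k)%:Z.
  move=> /negPf k0; rewrite -(perm_level_excess _ Lp') L_exc p_exc k0.
  by have := x'_eq k; rewrite (eq_sym u) (eq_sym v); lia.
have M_z' k : k != ord0 -> level_excess (multipath3_system q') k = - (z' k)%:Z.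
  move=> /negPf k0; rewrite -(perm_level_excess _ Mq') M_exc q_exc k0.
  by have := z'_eq k; rewrite (eq_sym u) (eq_sym v); lia.
have x'_p' : is_multipath3 (drop_x0 x') p'.
  by apply: (level_excess_is_multipath3 N1_layered N2_layered N3_layered);
    rewrite ?L_x' ?inord_neq0 // -(perm_path_system _ Lp').
have z'_q' : is_multipath3 (drop_x0 z') q'.
  by apply: (level_excess_is_multipath3 N1_layered N2_layered N3_layered);
    rewrite ?M_z' ?inord_neq0 // -(perm_path_system _ Mq').
apply: le_trans (leeD (max_weight_ge x'_p') (max_weight_ge z'_q')).
rewrite -!weight_multipath3_system -(perm_big _ Lp') -(perm_big _ Mq') /=.
by rewrite LM_weight.
Qed.

End MaxWeight.
Theorem theorem3p6 (R : realType) (n : nat)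
    (Pi1 Pi2 Pi3 : planar_network R n)
    (hPi1 : exists P : {set edge_seq Pi1}, is_multipath n P)
    (hPi2 : exists P : {set edge_seq Pi2}, is_multipath n P)
    (hPi3 : exists P : {set edge_seq Pi3}, is_multipath n P)
    (w1 : edge Pi1 -> \bar R) (w2 : edge Pi2 -> \bar R)
    (w3 : edge Pi3 -> \bar R)
    (hw1 : forall e : edge Pi1, w1 e <> +oo%E)
    (hw2 : forall e : edge Pi2, w2 e <> +oo%E)
    (hw3 : forall e : edge Pi3, w3 e <> +oo%E)
    (gamma delta alpha beta : nat * nat * nat)
    (hrhombus : small_rhombus n gamma delta alpha beta) :
  (max_weight w1 w2 w3 alpha + max_weight w1 w2 w3 beta
     <= max_weight w1 w2 w3 gamma + max_weight w1 w2 w3 delta)%E.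
Proof.
case: hrhombus => y [a [b [c [sum_y /and3P [ab ac bc] [-> ->] -> ->]]]].
have sum_eq (j : 'I_4) : (\sum_i (i == j) = 1)%N.
  by rewrite (bigD1 j) //= eqxx big1 // => i /negPf ->.
(* Only at [a] does [alpha] exceed [beta]. Moving one unit from [a] to [c] turns [alpha] into
   [delta], and the reverse move turns [beta] into [gamma]; hence the swap of the summands. *)
rewrite [leRHS]addeC; apply: (max_weight_exchange (u := c) (v := a) w1 w2 w3
  (planar_layered (embedding Pi1)) (planar_layered (embedding Pi2))
  (planar_layered (embedding Pi3))).
- by rewrite big_split -big_distrr /= sum_eq muln1.
- by rewrite !big_split /= !sum_eq -addnA.
- by rewrite !eqxx !(eq_sym c) (negPf ac) (negPf bc); lia.
- move=> k /negPf ->; lia.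
- move=> k; lia.
- move=> k; lia.
Qed.
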